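(* Let $n\ge 1$, $\nu\in\mathring{\mathcal{S}}^n$ and $R>0$. Let $\mathcal{C}\subset\mathbb{R}^n$ be the convex polytope whose vertices are the $2(2^n-1)$ points $$v_{\mathcal{I}}^\pm=\theta_0(\nu)\pm R\sum_{i\in\mathcal{I}}e_i,\qquad \emptyset\ne\mathcal{I}\subseteq\{1,\dots,n\},$$ which represents, in $\theta_0$-coordinates, the $\mathcal{H}$-ball of radius $R$ around $\theta_0(\nu)$ (i.e. $\mathcal{C}=\theta_0(\{\mu\in\mathring{\mathcal{S}}^n:\mathcal{H}(\mu,\nu)\le R\})$). Under the inverse transformation $\theta_0^{-1}:\mathbb{R}^n\to\mathring{\mathcal{S}}^n$, $\mathcal{C}$ maps to a convex polytope $\mathcal{D}=\theta_0^{-1}(\mathcal{C})\subset\mathring{\mathcal{S}}^n$ centred at $\nu$, and the vertices of $\mathcal{D}$ are given by the images under $\theta_0^{-1}$ of the vertices of $\mathcal{C}$.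
   Context: $\mathcal{S}^n=\{x\in\mathbb{R}_+^{n+1}:\sum_{i=0}^nx^i=1\}$ is the probability simplex (coordinates indexed by $0,\dots,n$) and $\mathring{\mathcal{S}}^n$ its interior, consisting of the points with all coordinates strictly positive. The map $\theta_0:\mathring{\mathcal{S}}^n\to\mathbb{R}^n$, $\theta_0^i(\mu)=\log(\mu^i/\mu^0)$ for $i=1,\dots,n$, is a bijection with inverse $\mu^i=e^{\theta^i}/\sum_{j=0}^ne^{\theta^j}$, $i=0,\dots,n$, where $\theta^0:=0$. $\{e_i\}_{i=1}^n$ is the standard basis of $\mathbb{R}^n$. For $\mu,\nu\in\mathring{\mathcal{S}}^n$ the Hilbert projective metric is $\mathcal{H}(\mu,\nu)=\log\frac{\max_i\mu^i/\nu^i}{\min_j\mu^j/\nu^j}$. ''Centred at $\nu$'' means that $\mathcal{D}$ is the closed $\mathcal{H}$-ball around $\nu$. *)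

(* Defs.v *)
From HB Require Import structures.
From mathcomp Require Import all_boot all_order all_algebra.
From mathcomp Require Import all_classical all_reals all_analysis.

Set Implicit Arguments.
Unset Strict Implicit.
Unset Printing Implicit Defensive.

Import Order.TTheory GRing.Theory Num.Theory.
Import numFieldNormedType.Exports.

Local Open Scope classical_set_scope.
Local Open Scope ring_scope.

(* The coordinates 0, ..., n of a point of R^(n+1) are indexed by 'I_n.+1.  A
   point of R^n has coordinates 1, ..., n, and coordinate i.+1 is the entry at
   i : 'I_n, so that it corresponds to the index lift ord0 i : 'I_n.+1. *)

Definition simplex_interior {R : realType} {n : nat} : set 'rV[R]_n.+1 :=
  [set mu | (forall i, 0 < mu 0 i) /\ \sum_i mu 0 i = 1].

Definition theta0 {R : realType} {n : nat} (mu : 'rV[R]_n.+1) : 'rV[R]_n :=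
  \row_i ln (mu 0 (lift ord0 i) / mu 0 ord0).

(* theta preceded by the convention theta^0 := 0. *)
Definition theta_ext {R : realType} {n : nat} (theta : 'rV[R]_n) (i : 'I_n.+1) : R :=
  if unlift ord0 i is Some j then theta 0 j else 0.

Definition theta0_inv {R : realType} {n : nat} (theta : 'rV[R]_n) : 'rV[R]_n.+1 :=
  \row_i (expR (theta_ext theta i) / \sum_j expR (theta_ext theta j)).

Lemma sum_expR_gt0 {R : realType} {n : nat} (theta : 'rV[R]_n) :
  0 < \sum_j expR (theta_ext theta j).
Proof.
rewrite (bigD1 ord0) //= ltr_pwDl ?expR_gt0 //.
by apply: sumr_ge0 => i _; exact: expR_ge0.
Qed.

Lemma theta0_inv_interior {R : realType} {n : nat} (theta : 'rV[R]_n) :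
  simplex_interior (theta0_inv theta).
Proof.
split=> [i|]; first by rewrite mxE divr_gt0 ?expR_gt0 ?sum_expR_gt0.
under eq_bigr do rewrite mxE.
by rewrite -mulr_suml divff // gt_eqF ?sum_expR_gt0.
Qed.

Lemma theta0_invK {R : realType} {n : nat} (theta : 'rV[R]_n) :
  theta0 (theta0_inv theta) = theta.
Proof.
apply/rowP => i; rewrite !mxE {1}/theta_ext liftK /theta_ext unlift_none expR0.
by rewrite mul1r invrK divfK ?expRK // gt_eqF ?sum_expR_gt0.
Qed.

Lemma theta0K {R : realType} {n : nat} (mu : 'rV[R]_n.+1) :
  simplex_interior mu -> theta0_inv (theta0 mu) = mu.
Proof.
move=> [mu_gt0 mu_sum].
have expE i : expR (theta_ext (theta0 mu) i) = mu 0 i / mu 0 ord0.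
  rewrite /theta_ext; case: unliftP => [j|] ->.
    by rewrite mxE lnK // posrE divr_gt0.
  by rewrite expR0 divff // gt_eqF.
apply/rowP => i; rewrite mxE expE.
under eq_bigr do rewrite expE.
by rewrite -mulr_suml mu_sum mul1r invrK divfK // gt_eqF.
Qed.

(* The default values of the big operators are themselves terms of the family,
   so that they do not change the maximum and the minimum. *)
Definition hilbert_metric {R : realType} {n : nat} (mu nu : 'rV[R]_n.+1) : R :=
  ln (\big[Num.max/mu 0 ord0 / nu 0 ord0]_i (mu 0 i / nu 0 i) /
      \big[Num.min/mu 0 ord0 / nu 0 ord0]_j (mu 0 j / nu 0 j)).

Definition hilbert_ball {R : realType} {n : nat} (nu : 'rV[R]_n.+1) (r : R) :
    set 'rV[R]_n.+1 :=
  [set mu | simplex_interior mu /\ hilbert_metric mu nu <= r].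

Definition conv_hull {R : realType} {E : lmodType R} (A : set E) : set E :=
  smallest [set B : set E | convex_set (M := E) B] A.

Definition convex_polytope {R : realType} {E : lmodType R} (P : set E) : Prop :=
  exists2 V : set E, finite_set V & P = conv_hull V.

(* The vertices of a convex polytope are its extreme points. *)
Definition vertices {R : realType} {E : lmodType R} (P : set E) : set E :=
  [set x | P x /\
    forall (y z : E) (t : R), P y -> P z -> 0 < t < 1 ->
      x = t *: y + (1 - t) *: z -> y = x /\ z = x].

Definition vertex_points {R : realType} {n : nat} (nu : 'rV[R]_n.+1) (r : R) :
    set 'rV[R]_n :=
  [set v | exists2 I : {set 'I_n}, I != finset.set0 &
    v = theta0 nu + r *: \sum_(i in I) delta_mx 0 i \/
    v = theta0 nu - r *: \sum_(i in I) delta_mx 0 i].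

(* Main.v *)
Require Import Defs.
From mathcomp Require Import all_boot all_order all_algebra.
From mathcomp Require Import all_classical all_reals all_analysis.
From mathcomp Require Import ring lra.
Import Order.TTheory GRing.Theory Num.Theory.
Local Open Scope classical_set_scope.
Local Open Scope ring_scope.

(* Write x^0 = 0 and dev for the coordinates of x - theta0 nu.  Both balls are
   cut out by facet inequalities indexed by pairs (i, j): the ball C by
   dev_i - dev_j <= r, and D by mu_i / nu_i <= e^r mu_j / nu_j, which is the same
   condition after exponentiation.  Up to translating the extended coordinates of
   C, or rescaling the ratios of D, a point of either ball is the image of a point
   of a cube [a, b]^(n+1), under an affine map for C and a projective one for D.
   Such maps send segments to segments, so the balls are the hulls of the images
   of the cube vertices.  These are indexed by subsets J of {0, ..., n}; the
   trivial J give the centre, which lies between the images of J and of its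
   complement, and the others are extreme because the facets (i, j) with i in J
   and j not in J meet in that point only. *)

(** * Convex hulls, extreme points and cubes *)

Lemma convex_setP (R : realType) (E : lmodType R) (A : set E) :
  convex_set (M := E) A <->
  forall x y t, 0 < t < 1 -> A x -> A y -> A (t *: x + (1 - t) *: y).
Proof.
rewrite convex_setW; split=> [cA x y t /andP[t0 t1] Ax Ay|cA x y].
  apply: set_mem; exact: (cA x y (mem_set Ax) (mem_set Ay)
    (Itv01 (ltW t0) (ltW t1)) t0 t1).
rewrite !inE => Ax Ay k k0 k1.
by apply: mem_set; apply: (@cA x y k%:num _ Ax Ay); rewrite k0 k1.
Qed.

Lemma conv_hull_convex (R : realType) (E : lmodType R) (A : set E) :
  convex_set (M := E) (conv_hull A).
Proof.
apply/convex_setP => x y t t01 Ax Ay B [cB AB].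
by move/convex_setP: (cB); apply => //; [exact: Ax|exact: Ay].
Qed.

(** Removing an extreme point from a convex set leaves a convex set, so an extreme point outside [A]
    could be dropped from the hull, against minimality. *)
Lemma vertices_conv_hull (R : realType) (E : lmodType R) (A : set E) :
  vertices (conv_hull A) `<=` A.
Proof.
move=> x [Hx xext]; apply: contrapT => nAx.
have : (conv_hull A `\ x) x.
  apply: Hx; split; last first.
    move=> y Ay; split; first exact: sub_gen_smallest.
    by move=> yx; apply: nAx; rewrite -yx.
  apply/convex_setP => y z t t01 [Hy yx] [Hz zx]; split.
    by move/convex_setP: (@conv_hull_convex _ _ A); apply.
  by move=> /= e; have [/yx] := xext y z t Hy Hz t01 (esym e).
by case=> _; apply.
Qed.

(** If [l k] vanishes strictly inside a segment of [P], two nonnegative terms with positive weights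
    add up to 0, so it vanishes at both endpoints; the common zero of these functions is unique. *)
Lemma vertices_facets (R : realType) (E : lmodType R) (P : set E) (K : Type)
    (S : set K) (l : K -> E -> R) (x : E) :
  (forall k y z t, l k (t *: y + (1 - t) *: z) = t * l k y + (1 - t) * l k z) ->
  (forall k y, P y -> 0 <= l k y) ->
  P x -> (forall k, S k -> l k x = 0) ->
  (forall y, P y -> (forall k, S k -> l k y = 0) -> y = x) ->
  vertices P x.
Proof.
move=> lconv l_ge0 Px lx0 uniq; split=> // y z t Py Pz /andP[t0 t1] xE.
have s0 : 0 < 1 - t by rewrite subr_gt0.
suff l0 k : S k -> l k y = 0 /\ l k z = 0.
  by split; apply: uniq => // k /l0[].
move=> Sk; have := lx0 k Sk; rewrite xE lconv => /eqP.
rewrite paddr_eq0 ?mulr_ge0 ?l_ge0 ?(ltW t0) ?(ltW s0)// !mulf_eq0.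
by rewrite (gt_eqF t0) (gt_eqF s0)/= => /andP[/eqP ? /eqP].
Qed.

(* The constant points are the only cube vertices not covered by the last
   hypothesis: they are reached from a midpoint of two opposite vertices. *)
Lemma box_ind (R : realType) (n : nat) (a b : R) (P : set 'rV[R]_n.+1) :
  (0 < n)%N -> a < b ->
  (forall (x y : 'rV[R]_n.+1) t, 0 < t < 1 -> (forall i, a <= x 0 i <= b) ->
    (forall i, a <= y 0 i <= b) -> P x -> P y -> P (t *: x + (1 - t) *: y)) ->
  (forall s s', a <= s <= b -> a <= s' <= b ->
    P (const_mx s) -> P (const_mx s')) ->
  (forall J : {set 'I_n.+1}, J != finset.set0 -> J != [set: 'I_n.+1]%SET ->
    P (\row_i if i \in J then b else a)) ->
  forall x : 'rV[R]_n.+1, (forall i, a <= x 0 i <= b) -> P x.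
Proof.
move=> n0 ab Pconv Pconst Pvert x.
have [le_ab le_aa le_bb] : [/\ a <= b, a <= a & b <= b] by rewrite (ltW ab) !lexx.
have Pdiag s : a <= s <= b -> P (const_mx s).
  move=> s_ab; pose J := [set (ord0 : 'I_n.+1)]%SET.
  have J0 : J != finset.set0 by apply/set0Pn; exists ord0; rewrite !inE.
  have JT : J != [set: 'I_n.+1]%SET.
    apply/eqP => /(congr1 (fun A : {set _} => #|A|)).
    by rewrite cards1 cardsT card_ord => -[n0']; rewrite -n0' in n0.
  have JC0 : ~: J != finset.set0.
    by apply: contraNneq JT => JC; rewrite -(finset.setCK J) JC finset.setC0.
  have JCT : ~: J != [set: 'I_n.+1]%SET.
    by apply: contraNneq J0 => JC; rewrite -(finset.setCK J) JC finset.setCT.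
  apply: (Pconst ((a + b) / 2)) => //; first by apply/andP; split; lra.
  have -> : const_mx ((a + b) / 2) = 2^-1 *: (\row_i if i \in J then b else a)
      + (1 - 2^-1) *: (\row_i if i \in ~: J then b else a) :> 'rV[R]_n.+1.
    by apply/rowP => i; rewrite !mxE finset.in_setC; case: (i \in J) => /=; field.
  apply: Pconv; try exact: Pvert; first by apply/andP; split; lra.
    by move=> i; rewrite mxE; case: ifP; rewrite ?le_ab ?lexx.
  by move=> i; rewrite mxE; case: ifP; rewrite ?le_ab ?lexx.
(* Induction on the number of entries strictly between [a] and [b]. *)
have [k] := ubnP #|[set i | a < x 0 i < b]%SET|; elim: k => // k IH in x * => xk x_ab.
have [/existsP[i xi]|/existsPn xI] := boolP [exists i, a < x 0 i < b]; last first.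
  pose J := [set i | x 0 i == b]%SET.
  have xE : x = \row_i if i \in J then b else a.
    apply/rowP => i; rewrite mxE inE; case: eqP => // xib.
    move: (xI i) (x_ab i); rewrite !lt_neqAle (introN eqP xib) /= => /nandP.
    by case=> [/nandP[|/negbTE->]//|/negbTE->]; rewrite ?andbF// negbK => /eqP.
  have [J0|J0] := eqVneq J finset.set0.
    suff -> : x = const_mx a by apply: Pdiag; rewrite le_aa le_ab.
    by rewrite xE J0; apply/rowP => i; rewrite !mxE inE.
  have [JT|JT] := eqVneq J [set: 'I_n.+1]%SET.
    suff -> : x = const_mx b by apply: Pdiag; rewrite le_ab le_bb.
    by rewrite xE JT; apply/rowP => i; rewrite !mxE inE.
  by rewrite xE; exact: Pvert.
(* Pushing entry [i] to [b] or to [a] lowers that number, and [x] lies between the two resulting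
   points, with weight [t] on the first. *)
pose y c : 'rV[R]_n.+1 := \row_j if j == i then c else x 0 j.
pose t := (x 0 i - a) / (b - a).
have Py c : (c == a) || (c == b) -> P (y c).
  move=> c_ab; apply: IH => [|j]; last first.
    rewrite mxE; case: ifP => // _.
    by case/orP: c_ab => /eqP ->; rewrite ?le_ab ?lexx.
  rewrite ltnS in xk; apply: leq_trans xk; apply: proper_card.
  apply/properP; split; last first.
    exists i; rewrite !inE ?mxE ?eqxx//.
    by case/orP: c_ab => /eqP ->; rewrite ltxx ?andbF.
  apply/fintype.subsetP => j; rewrite !inE mxE; case: (eqVneq j i) => // _.
  by case/orP: c_ab => /eqP ->; rewrite ltxx ?andbF.
have ba0 : b - a != 0 by rewrite subr_eq0 gt_eqF.
have -> : x = t *: y b + (1 - t) *: y a.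
  apply/rowP => j; rewrite !mxE /t; case: eqVneq => [->|_]; first by field.
  by field.
case/andP: xi => ai ib.
apply: Pconv; last 2 first.
- by apply: Py; rewrite eqxx orbT.
- by apply: Py; rewrite eqxx.
- by rewrite /t divr_gt0 ?subr_gt0//= ltr_pdivrMr ?subr_gt0// mul1r ltrD2r.
- by move=> j; rewrite mxE; case: ifP => // _; rewrite le_ab lexx.
- by move=> j; rewrite mxE; case: ifP => // _; rewrite le_ab lexx.
Qed.

Lemma exists_min_ord (R : realType) (n : nat) (f : 'I_n.+1 -> R) :
  exists i, forall j, f i <= f j.
Proof.
case: (arg_minP f (erefl : xpredT (@ord0 n))) => i _ min_i.
by exists i => j; exact: min_i.
Qed.

(** * The ball in logarithmic coordinates and its cut points *)

Definition dev {R : realType} {n : nat} (c x : 'rV[R]_n) (i : 'I_n.+1) : R :=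
  theta_ext x i - theta_ext c i.

(** This bounds the oscillation (max minus min) of the deviations without forming extrema; index 0,
    where the deviation is 0, takes part. *)
Definition variation_ball {R : realType} {n : nat} (c : 'rV[R]_n) (r : R) :
    set 'rV[R]_n :=
  [set x | forall i j, dev c x i - dev c x j <= r].

(* The vertex theta0 nu + r \sum_(i in I) e_i is the cut point of J = I, and
   theta0 nu - r \sum_(i in I) e_i that of the complement of I in {0, ..., n}. *)
Definition cut_point {R : realType} {n : nat} (c : 'rV[R]_n) (r : R)
    (J : {set 'I_n.+1}) : 'rV[R]_n :=
  \row_i (c 0 i + r * ((lift ord0 i \in J)%:R - (ord0 \in J)%:R)).

Definition cuts {n : nat} : set {set 'I_n.+1} :=
  [set J | J != finset.set0 /\ J != [set: 'I_n.+1]%SET].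

Lemma dev0 (R : realType) (n : nat) (c x : 'rV[R]_n) : dev c x ord0 = 0.
Proof. by rewrite /dev /theta_ext unlift_none subrr. Qed.

Lemma devS (R : realType) (n : nat) (c x : 'rV[R]_n) (i : 'I_n) :
  dev c x (lift ord0 i) = x 0 i - c 0 i.
Proof. by rewrite /dev /theta_ext liftK. Qed.

Lemma dev_inj (R : realType) (n : nat) (c x y : 'rV[R]_n) :
  dev c x =1 dev c y -> x = y.
Proof.
by move=> xy; apply/rowP => i; have := xy (lift ord0 i); rewrite !devS => /addIr.
Qed.

Lemma dev_conv (R : realType) (n : nat) (c x y : 'rV[R]_n) (t : R) i :
  dev c (t *: x + (1 - t) *: y) i = t * dev c x i + (1 - t) * dev c y i.
Proof.
by case: (unliftP ord0 i) => [j|] ->; rewrite ?dev0 ?devS ?mxE; ring.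
Qed.

Lemma dev_cut_point (R : realType) (n : nat) (c : 'rV[R]_n) (r : R) (J : {set 'I_n.+1}) i :
  dev c (cut_point c r J) i = r * ((i \in J)%:R - (ord0 \in J)%:R).
Proof.
by case: (unliftP ord0 i) => [j|] ->; rewrite ?dev0 ?devS ?mxE; ring.
Qed.

Lemma cutP (n : nat) (J : {set 'I_n.+1}) :
  cuts J <-> (exists i, i \in J) /\ exists j, j \notin J.
Proof.
split=> [[/set0Pn J0 JT]|[[i iJ] [j jJ]]].
  split=> //; apply/existsP; rewrite -negb_forall; apply: contra JT.
  by move=> /forallP JT; apply/eqP/setP => i; rewrite JT inE.
split; first by apply/set0Pn; exists i.
by apply: contraNneq jJ => ->; rewrite inE.
Qed.

(** The equations across the cut force the deviation to be constant on [J] and on its complement,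
    with gap [r]; its value 0 at index 0 fixes both constants. *)
Lemma cut_point_eq (R : realType) (n : nat) (c : 'rV[R]_n) (r : R) (J : {set 'I_n.+1}) x :
  cuts J -> (forall i j, i \in J -> j \notin J -> dev c x i - dev c x j = r) ->
  x = cut_point c r J.
Proof.
move=> /cutP[[i iJ] [j jJ]] xr; apply: (dev_inj _ _ c) => l.
rewrite dev_cut_point; have x0 := dev0 _ _ c x.
have := xr i j iJ jJ.
have [lJ|lJ] := boolP (l \in J); have [oJ|oJ] := boolP (ord0 \in J).
- by have := xr l j lJ jJ; have := xr _ j oJ jJ; rewrite x0 /=; lra.
- by have := xr l _ lJ oJ; rewrite x0 /=; lra.
- by have := xr _ l oJ lJ; rewrite x0 /=; lra.
- by have := xr i l iJ lJ; have := xr i _ iJ oJ; rewrite x0 /=; lra.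
Qed.

Lemma cut_point_facet (R : realType) (n : nat) (c : 'rV[R]_n) (r : R) (J : {set 'I_n.+1}) i j :
  i \in J -> j \notin J ->
  dev c (cut_point c r J) i - dev c (cut_point c r J) j = r.
Proof. by move=> iJ /negbTE jJ; rewrite !dev_cut_point iJ jJ /=; lra. Qed.

(** [J] can be read off its cut point: its elements are the indices whose deviation exceeds some
    other one by exactly [r]. *)
Lemma cut_point_inj (R : realType) (n : nat) (c : 'rV[R]_n) (r : R) :
  0 < r -> {in @cuts n &, injective (cut_point c r)}.
Proof.
move=> r0 J J' /set_mem cJ /set_mem cJ' eqJ.
suff mem_cut K i : cuts K -> i \in K <->
    exists j, dev c (cut_point c r K) i - dev c (cut_point c r K) j = r.
  apply/setP => i; apply/idP/idP.
    by move/(mem_cut _ _ cJ); rewrite eqJ => /(mem_cut _ _ cJ').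
  by move/(mem_cut _ _ cJ'); rewrite -eqJ => /(mem_cut _ _ cJ).
move=> /cutP[_ [j jK]]; split=> [iK|[k]].
  by exists j; exact: cut_point_facet.
rewrite !dev_cut_point; case: (i \in K) => //=.
by case: (k \in K); case: (ord0 \in K) => /=; lra.
Qed.

Lemma cut_point_variation_ball (R : realType) (n : nat) (c : 'rV[R]_n) (r : R) (J : {set 'I_n.+1}) :
  0 < r -> variation_ball c r (cut_point c r J).
Proof.
move=> r0 i j; rewrite !dev_cut_point.
by case: (i \in J); case: (j \in J); case: (ord0 \in J) => /=; lra.
Qed.

(** * Counting the cuts and matching them with the given vertices *)

Lemma card_cut (n : nat) : (@cuts n #= `I_(2 * (2 ^ n - 1)))%card.
Proof.
pose A := ([set: {set 'I_n.+1}] :\ finset.set0 :\ [set: 'I_n.+1])%SET.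
have -> : cuts = [set` A].
  apply/seteqP; split=> J /=; rewrite /cuts /= !inE andbT; first by case=> -> ->.
  by case/andP=> -> ->.
(* The [2 ^ n.+1] subsets lose the empty one and the full one. *)
have -> : (2 * (2 ^ n - 1))%N = #|A|.
  have cT : #|[set: {set 'I_n.+1}]%SET| = (2 ^ n.+1)%N.
    by rewrite -powersetT card_powerset cardsT card_ord.
  have := cardsD1 [set: 'I_n.+1]%SET ([set: {set 'I_n.+1}] :\ finset.set0)%SET.
  have := cardsD1 finset.set0 [set: {set 'I_n.+1}]%SET.
  have T0 : [set: 'I_n.+1]%SET != finset.set0.
    by apply/set0Pn; exists ord0; rewrite inE.
  rewrite !inE T0 cT /= -/A expnS mulnBr => -> ->.
  by rewrite muln1 addnA addKn.
have -> : [set` A] = (@enum_val _ (mem A)) @` [set: 'I_#|A|].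
  apply/seteqP; split=> [J /= JA|J [i _ <-]]; last exact: enum_valP.
  by exists (enum_rank_in JA J) => //; rewrite enum_rankK_in.
apply: card_eq_trans (inj_card_eq _) _; first by move=> i j _ _; exact: enum_val_inj.
by rewrite card_eq_sym card_II.
Qed.

Lemma vertex_points_cut (R : realType) (n : nat) (nu : 'rV[R]_n.+1) (r : R) :
  vertex_points nu r = cut_point (theta0 nu) r @` cuts.
Proof.
have sumE (I : {set 'I_n}) i :
    (\sum_(k in I) delta_mx 0 k : 'rV[R]_n) 0 i = (i \in I)%:R.
  rewrite summxE; under eq_bigr do rewrite mxE eqxx /=.
  have [iI|iI] := boolP (i \in I).
    rewrite (bigD1 i)//= eqxx big1 ?addr0// => k /andP[_ /negbTE ki].
    by rewrite eq_sym ki.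
  rewrite big1// => k kI; case: eqP => // ik.
  by rewrite ik kI in iI.
have lift_inj := @lift_inj n.+1 ord0.
apply/seteqP; split=> [_ [I /set0Pn[i0 i0I] [] ->]|_ [J [J0 JT] <-]].
- pose J := (lift ord0 @: I)%SET.
  have oJ : ord0 \notin J by apply/imsetP => -[k _ /eqP]; rewrite (negbTE (neq_lift _ _)).
  exists J; first by apply/cutP; split; [exists (lift ord0 i0); exact: imset_f|exists ord0].
  apply/rowP => i; rewrite !mxE sumE (negbTE oJ) mem_imset//=.
  by rewrite subr0.
- pose J := (~: (lift ord0 @: I))%SET.
  have oJ : ord0 \in J.
    by rewrite inE; apply/imsetP => -[k _ /eqP]; rewrite (negbTE (neq_lift _ _)).
  exists J.
    apply/cutP; split; [by exists ord0|exists (lift ord0 i0)].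
    by rewrite inE negbK imset_f.
  apply/rowP => i; rewrite !mxE sumE oJ inE mem_imset//=.
  by case: (i \in I) => /=; ring.
(* If 0 lies in [J], subtracting the entry at 0 turns the indicator of [J] into minus that of its
   complement; this gives the vertices with a minus sign. *)
- have [oJ|oJ] := boolP (ord0 \in J).
    exists [set i | lift ord0 i \notin J]%SET.
      apply: contraNneq JT => /setP J'0; apply/eqP/setP => i; rewrite inE.
      case: (unliftP ord0 i) => [j|] -> //; have := J'0 j.
      by rewrite !inE => /negbFE.
    right; apply/rowP => i; rewrite !mxE sumE oJ inE.
    by case: (_ \in J) => /=; ring.
  exists [set i | lift ord0 i \in J]%SET.
    apply: contraNneq J0 => /setP J'0; apply/eqP/setP => i; rewrite [RHS]inE.
    case: (unliftP ord0 i) => [j|] ->; last exact: negbTE.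
    by have := J'0 j; rewrite !inE.
  left; apply/rowP => i; rewrite !mxE sumE (negbTE oJ) inE.
  by rewrite subr0.
Qed.

(** * Hull and extreme points in logarithmic coordinates *)

Lemma variation_ball_convex (R : realType) (n : nat) (c : 'rV[R]_n) (r : R) :
  convex_set (M := 'rV[R]_n) (variation_ball c r).
Proof.
apply/convex_setP => x y t /andP[t0 t1] xr yr i j.
rewrite !dev_conv; have := xr i j; have := yr i j; nra.
Qed.

Lemma conv_hull_cut_point (R : realType) (n : nat) (c : 'rV[R]_n) (r : R) :
  (0 < n)%N -> 0 < r ->
  conv_hull (cut_point c r @` cuts) = variation_ball c r.
Proof.
move=> n0 r0; apply/seteqP; split.
  apply: smallest_sub; first exact: variation_ball_convex.
  by move=> _ [J _ <-]; exact: cut_point_variation_ball.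
(* [m] is an index of least deviation, so all deviations lie in an interval of length [r] starting
   there: the side of the cube. *)
move=> x xr; have [m min_m] := exists_min_ord _ _ (dev c x).
(* [phi] is affine, undoes [dev] and ignores a common shift of all entries, so it sends the whole
   diagonal to [c]. *)
pose phi (u : 'rV[R]_n.+1) := \row_i (c 0 i + (u 0 (lift ord0 i) - u 0 ord0)).
have phi_const s : phi (const_mx s) = c.
  by apply/rowP => i; rewrite !mxE subrr addr0.
have -> : x = phi (\row_i dev c x i).
  by apply/rowP => i; rewrite !mxE dev0 devS; ring.
apply: (box_ind _ _ (dev c x m) (dev c x m + r)
  (fun u => conv_hull (cut_point c r @` cuts) (phi u))) => //.
- by rewrite ltrDl.
- move=> u v t t01 _ _ Pu Pv.
  have -> : phi (t *: u + (1 - t) *: v) = t *: phi u + (1 - t) *: phi v.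
    by apply/rowP => i; rewrite !mxE; ring.
  by have /convex_setP := conv_hull_convex _ _ (cut_point c r @` cuts); apply.
- by move=> s s' _ _; rewrite !phi_const.
- move=> J J0 JT; apply: sub_gen_smallest; exists J => //.
  apply/rowP => i; rewrite !mxE.
  by case: (_ \in J); case: (_ \in J) => /=; ring.
- move=> i; rewrite mxE min_m /=; have := xr i m; lra.
Qed.

Lemma vertices_variation_ball (R : realType) (n : nat) (c : 'rV[R]_n) (r : R) :
  (0 < n)%N -> 0 < r -> vertices (variation_ball c r) = cut_point c r @` cuts.
Proof.
move=> n0 r0; apply/seteqP; split.
  by rewrite -conv_hull_cut_point//; exact: vertices_conv_hull.
move=> _ [J cJ <-].
apply: (vertices_facets _ _ _ _ [set k | k.1 \in J /\ k.2 \notin J]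
  (fun k x => r - (dev c x k.1 - dev c x k.2))).
- by move=> k y z t; rewrite !dev_conv; ring.
- by move=> k y yr; rewrite subr_ge0.
- exact: cut_point_variation_ball.
- by move=> k [k1 k2]; rewrite cut_point_facet ?subrr.
- move=> y _ yJ; apply: cut_point_eq => // i j iJ jJ.
  by have /= := yJ (i, j) (conj iJ jJ) => /eqP; rewrite subr_eq0 => /eqP.
Qed.

(** * The Hilbert ball through linear inequalities and as an image *)

Lemma hilbert_ballE (R : realType) (n : nat) (nu mu : 'rV[R]_n.+1) (r : R) :
  simplex_interior nu -> simplex_interior mu ->
  hilbert_ball nu r mu <->
  forall i j, mu 0 i / nu 0 i <= expR r * (mu 0 j / nu 0 j).
Proof.
move=> [nu_gt0 _] mu_int; have [mu_gt0 _] := mu_int.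
rewrite /hilbert_ball /= /hilbert_metric.
pose f i := mu 0 i / nu 0 i.
have f_gt0 i : 0 < f i by rewrite divr_gt0.
rewrite -[mu 0 ord0 / nu 0 ord0]/(f ord0).
set M := \big[Num.max/f ord0]_i f i; set m := \big[Num.min/f ord0]_j f j.
have m_gt0 : 0 < m by exact: lt_bigmin.
have M_gt0 : 0 < M by apply: lt_le_trans (le_bigmax _ _ ord0).
(* Exponentiating and clearing the positive minimum leaves a bound of the maximum by [expR r] times
   the minimum, that is, a comparison of all pairs of ratios. *)
have -> : (ln (M / m) <= r) = (M <= expR r * m).
  by rewrite -ler_expR lnK ?posrE ?divr_gt0// ler_pdivrMr.
split=> [[_ Mm] i j|fr].
  apply: le_trans (le_bigmax _ _ i) (le_trans Mm _).
  by rewrite ler_pM2l ?expR_gt0//; exact: bigmin_le.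
split=> //.
have fm i : f i <= expR r * m.
  rewrite mulrC -ler_pdivrMr ?expR_gt0//; apply/bigmin_geP.
  by split=> [|j _]; rewrite ler_pdivrMr ?expR_gt0// mulrC; exact: fr.
by apply/bigmax_leP; split=> [|i _]; exact: fm.
Qed.

(** Both normalising sums go into [K], which does not depend on [i] and cancels when two ratios are
    compared. *)
Lemma theta0_inv_ratio (R : realType) (n : nat) (nu : 'rV[R]_n.+1) :
  simplex_interior nu -> forall x, exists2 K : R, 0 < K &
  forall i, theta0_inv x 0 i / nu 0 i = K * expR (dev (theta0 nu) x i).
Proof.
move=> hnu x; set c := theta0 nu.
exists ((\sum_j expR (theta_ext c j)) / \sum_j expR (theta_ext x j)).
  by rewrite divr_gt0 ?sum_expR_gt0.
move=> i; rewrite -{1}(theta0K hnu) -/c !mxE /dev expRD expRN.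
have := sum_expR_gt0 c; have := sum_expR_gt0 x.
move: (\sum_j _) (\sum_j _) => A B A0 B0.
by field; rewrite !gt_eqF ?expR_gt0.
Qed.

Lemma hilbert_ball_theta0_inv (R : realType) (n : nat) (nu : 'rV[R]_n.+1) (r : R) x :
  simplex_interior nu ->
  hilbert_ball nu r (theta0_inv x) <-> variation_ball (theta0 nu) r x.
Proof.
move=> hnu; rewrite hilbert_ballE//; last exact: theta0_inv_interior.
have [K K0 ratioE] := theta0_inv_ratio _ _ nu hnu x.
have le_dev i j : (theta0_inv x 0 i / nu 0 i <= expR r * (theta0_inv x 0 j / nu 0 j))
    = (dev (theta0 nu) x i - dev (theta0 nu) x j <= r).
  by rewrite !ratioE mulrCA ler_pM2l// -expRD ler_expR -lerBlDr.
by split=> xr i j; have := xr i j; rewrite le_dev.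
Qed.

Lemma hilbert_ball_image (R : realType) (n : nat) (nu : 'rV[R]_n.+1) (r : R) :
  simplex_interior nu ->
  hilbert_ball nu r = theta0_inv @` variation_ball (theta0 nu) r.
Proof.
move=> hnu; apply/seteqP; split=> [mu mu_r|_ [x xr <-]].
  have [mu_int _] := mu_r; exists (theta0 mu); last exact: theta0K.
  by apply/hilbert_ball_theta0_inv => //; rewrite theta0K.
exact/hilbert_ball_theta0_inv.
Qed.

(** For fixed [nu], the inequalities of [hilbert_ballE] are linear in the point. *)
Lemma hilbert_ball_convex (R : realType) (n : nat) (nu : 'rV[R]_n.+1) (r : R) :
  simplex_interior nu -> convex_set (M := 'rV[R]_n.+1) (hilbert_ball nu r).
Proof.
move=> hnu; apply/convex_setP => x y t /andP[t0 t1] xr yr.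
have [[x_gt0 x1] _] := xr; have [[y_gt0 y1] _] := yr.
have s0 : 0 < 1 - t by rewrite subr_gt0.
move/hilbert_ballE : (xr) => /(_ hnu (proj1 xr)) {}xr.
move/hilbert_ballE : (yr) => /(_ hnu (proj1 yr)) {}yr.
apply/hilbert_ballE => //.
  split=> [i|]; first by rewrite !mxE addr_gt0// mulr_gt0.
  under eq_bigr do rewrite !mxE.
  by rewrite big_split /= -!mulr_sumr x1 y1; ring.
(* Generalizing [1 - t] keeps [mulrDl] from distributing it. *)
move: (1 - t) s0 => s s0 i j; rewrite !mxE !mulrDl -!mulrA mulrDr.
by apply: lerD; rewrite [leRHS]mulrCA ler_pM2l.
Qed.

(** * The projective map from ratios to the simplex *)

(** Rescales [nu] coordinatewise by the weights [w] and normalises the sum to 1; it recovers a point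
    of the simplex from its ratios to [nu]. *)
Definition weigh {R : realType} {n : nat} (nu w : 'rV[R]_n.+1) : 'rV[R]_n.+1 :=
  \row_i (nu 0 i * w 0 i / \sum_j nu 0 j * w 0 j).

Lemma weigh_conv (R : realType) (n : nat) (nu x y : 'rV[R]_n.+1) (t : R) :
  (forall i, 0 < nu 0 i) -> (forall i, 0 < x 0 i) -> (forall i, 0 < y 0 i) ->
  0 < t < 1 -> exists2 s, 0 < s < 1 &
    weigh nu (t *: x + (1 - t) *: y) = s *: weigh nu x + (1 - s) *: weigh nu y.
Proof.
move=> nu_gt0 x_gt0 y_gt0 /andP[t0 t1].
have s0 : 0 < 1 - t by rewrite subr_gt0.
have sum_gt0 (w : 'rV[R]_n.+1) : (forall i, 0 < w 0 i) -> 0 < \sum_j nu 0 j * w 0 j.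
  move=> w_gt0; rewrite big_ord_recl ltr_pwDl ?mulr_gt0//.
  by apply: sumr_ge0 => i _; rewrite mulr_ge0// ltW.
have {x_gt0}X0 := sum_gt0 _ x_gt0; have {y_gt0}Y0 := sum_gt0 _ y_gt0.
set X := \sum_j _ in X0; set Y := \sum_j _ in Y0.
have sumE : \sum_j nu 0 j * (t *: x + (1 - t) *: y) 0 j = t * X + (1 - t) * Y.
  rewrite !mulr_sumr -big_split; apply: eq_bigr => j _.
  by rewrite !mxE /=; ring.
have tX : 0 < t * X by rewrite mulr_gt0.
have sY : 0 < (1 - t) * Y by rewrite mulr_gt0.
have Z0 : 0 < t * X + (1 - t) * Y by rewrite addr_gt0.
(* The new weight of the first endpoint is its share of the total mass before normalisation. *)
exists (t * X / (t * X + (1 - t) * Y)).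
  by rewrite divr_gt0//= ltr_pdivrMr// mul1r ltrDl.
apply/rowP => i; rewrite !mxE sumE -/X -/Y.
by field; rewrite !gt_eqF.
Qed.

Lemma weigh_scale (R : realType) (n : nat) (nu w : 'rV[R]_n.+1) (k : R) :
  k != 0 -> weigh nu (k *: w) = weigh nu w.
Proof.
move=> k0; apply/rowP => i; rewrite !mxE.
under eq_bigr do rewrite mxE mulrCA.
by rewrite -mulr_sumr mulrCA -mulf_div divff// mul1r.
Qed.

Lemma weigh_const (R : realType) (n : nat) (nu : 'rV[R]_n.+1) (s : R) :
  simplex_interior nu -> s != 0 -> weigh nu (const_mx s) = nu.
Proof.
move=> [_ nu1] s0; apply/rowP => i; rewrite !mxE.
under eq_bigr do rewrite mxE.
by rewrite -mulr_suml nu1 mul1r mulfK.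
Qed.

Lemma weigh_ratio (R : realType) (n : nat) (nu mu : 'rV[R]_n.+1) :
  simplex_interior nu -> simplex_interior mu ->
  weigh nu (\row_i (mu 0 i / nu 0 i)) = mu.
Proof.
move=> [nu_gt0 _] [_ mu1].
have E i : nu 0 i * (mu 0 i / nu 0 i) = mu 0 i by rewrite mulrC divfK ?gt_eqF.
apply/rowP => i; rewrite !mxE E.
under eq_bigr do rewrite mxE E.
by rewrite mu1 divr1.
Qed.

Lemma weigh_cut (R : realType) (n : nat) (nu : 'rV[R]_n.+1) (r a : R)
    (J : {set 'I_n.+1}) :
  simplex_interior nu -> 0 < a ->
  weigh nu (\row_i if i \in J then a * expR r else a) =
  theta0_inv (cut_point (theta0 nu) r J).
Proof.
move=> hnu a0; set x := cut_point _ _ _.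
have [K K0 ratioE] := theta0_inv_ratio _ _ nu hnu x.
rewrite -[RHS](weigh_ratio _ _ nu)//; last exact: theta0_inv_interior.
(* The exponential undoes the shift that makes [dev] vanish at index 0, and [a] is the value of the
   cube vertex off [J]. *)
pose k := K * expR (- (r * (ord0 \in J)%:R)) / a.
have -> : \row_i (theta0_inv x 0 i / nu 0 i) =
    k *: (\row_i if i \in J then a * expR r else a).
  apply/rowP => i; rewrite [LHS]mxE ratioE dev_cut_point !mxE mulrBr expRD /k.
  case: (i \in J); rewrite /= ?mulr1 ?mulr0 ?expR0; field; exact: lt0r_neq0.
by rewrite weigh_scale// lt0r_neq0// divr_gt0// mulr_gt0// expR_gt0.
Qed.

(** * Hull and extreme points of the Hilbert ball *)

Lemma conv_hull_theta0_inv (R : realType) (n : nat) (nu : 'rV[R]_n.+1) (r : R) :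
  (0 < n)%N -> simplex_interior nu -> 0 < r ->
  conv_hull (theta0_inv @` (cut_point (theta0 nu) r @` cuts)) = hilbert_ball nu r.
Proof.
move=> n0 hnu r0; have [nu_gt0 _] := hnu; apply/seteqP; split.
  apply: smallest_sub; first exact: hilbert_ball_convex.
  move=> _ [_ [J _ <-] <-]; apply/hilbert_ball_theta0_inv => //.
  exact: cut_point_variation_ball.
move=> mu mu_r; have [mu_int _] := mu_r; have [mu_gt0 _] := mu_int.
move/hilbert_ballE : mu_r => /(_ hnu mu_int) mu_r.
(* The least ratio [a] is the lower end of the cube; membership in the ball bounds every ratio by
   [a * expR r]. *)
have [m min_m] := exists_min_ord _ _ (fun i => mu 0 i / nu 0 i).
set a := mu 0 m / nu 0 m in min_m.
have a0 : 0 < a by rewrite divr_gt0.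
rewrite -(weigh_ratio _ _ nu mu)//.
apply: (box_ind _ _ a (a * expR r)
  (fun u => conv_hull (theta0_inv @` (cut_point (theta0 nu) r @` cuts)) (weigh nu u))) => //.
- by rewrite ltr_pMr// expR_gt1.
- move=> u v t t01 u_ab v_ab Pu Pv.
  have gt0 (w : 'rV[R]_n.+1) : (forall i, a <= w 0 i <= a * expR r) -> forall i, 0 < w 0 i.
    by move=> w_ab i; have /andP[/(lt_le_trans a0)] := w_ab i.
  have [s s01 ->] := weigh_conv _ _ nu u v t nu_gt0 (gt0 _ u_ab) (gt0 _ v_ab) t01.
  by move/convex_setP: (conv_hull_convex _ _ (theta0_inv @` (cut_point (theta0 nu) r @` cuts))); apply.
- move=> s s' /andP[/(lt_le_trans a0) s0 _] /andP[/(lt_le_trans a0) s'0 _].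
  by rewrite !weigh_const ?lt0r_neq0.
- move=> J J0 JT; apply: sub_gen_smallest; rewrite weigh_cut//.
  by do 2![apply: imageP].
- by move=> i; rewrite mxE min_m /= [leRHS]mulrC; exact: mu_r.
Qed.

Lemma vertices_hilbert_ball (R : realType) (n : nat) (nu : 'rV[R]_n.+1) (r : R) :
  (0 < n)%N -> simplex_interior nu -> 0 < r ->
  vertices (hilbert_ball nu r) = theta0_inv @` (cut_point (theta0 nu) r @` cuts).
Proof.
move=> n0 hnu r0; apply/seteqP; split.
  by rewrite -conv_hull_theta0_inv//; exact: vertices_conv_hull.
move=> _ [_ [J cJ <-] <-].
(* These facet functions are linear in [mu], and [l k] vanishes at [theta0_inv x] exactly when [x]
   satisfies the facet equation for [k], so uniqueness reduces to [cut_point_eq]. *)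
pose l (k : 'I_n.+1 * 'I_n.+1) (mu : 'rV[R]_n.+1) :=
  expR r * (mu 0 k.2 / nu 0 k.2) - mu 0 k.1 / nu 0 k.1.
have l0 k x : l k (theta0_inv x) = 0 <->
    dev (theta0 nu) x k.1 - dev (theta0 nu) x k.2 = r.
  have [K K0 ratioE] := theta0_inv_ratio _ _ nu hnu x.
  rewrite /l !ratioE mulrCA -expRD; split=> [/subr0_eq|<-].
    by move/(mulfI (lt0r_neq0 K0))/expR_inj <-; rewrite addrK.
  by rewrite subrK subrr.
apply: (vertices_facets _ _ _ _ [set k | k.1 \in J /\ k.2 \notin J] l).
- by move=> k y z t; rewrite /l !mxE; ring.
- move=> k y y_r; have [y_int _] := y_r.
  move/hilbert_ballE : y_r => /(_ hnu y_int) y_r.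
  by rewrite subr_ge0.
- by apply/hilbert_ball_theta0_inv => //; exact: cut_point_variation_ball.
- by move=> k [k1 k2]; apply/l0; rewrite cut_point_facet.
- rewrite hilbert_ball_image// => _ [x _ <-] xJ; congr theta0_inv.
  apply: cut_point_eq => // i j iJ jJ.
  by have /l0 := xJ (i, j) (conj iJ jJ).
Qed.

Theorem lemma4p4 (R : realType) (n : nat) (nu : 'rV[R]_n.+1) (r : R)
    (hn : (1 <= n)%N) (hnu : simplex_interior nu) (hr : 0 < r) :
  let C : set 'rV[R]_n := conv_hull (vertex_points nu r) in
  let D : set 'rV[R]_n.+1 := theta0_inv @` C in
  [/\ vertices C = vertex_points nu r,
      (vertex_points nu r #= `I_(2 * (2 ^ n - 1)))%card,
      C = theta0 @` hilbert_ball nu r &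
      [/\ convex_polytope D,
          D `<=` simplex_interior,
          D = hilbert_ball nu r &
          vertices D = theta0_inv @` vertices C]].
Proof.
rewrite vertex_points_cut /= conv_hull_cut_point// vertices_variation_ball//.
(* From here on [D] is the Hilbert ball itself. *)
rewrite -hilbert_ball_image//; split=> //.
- by apply: card_eq_trans (inj_card_eq _) (card_cut n); exact: cut_point_inj.
- rewrite hilbert_ball_image// image_comp; apply/seteqP; split=> [x xr|_ [x xr <-]].
    by exists x => //=; rewrite theta0_invK.
  by rewrite /= theta0_invK.
split=> //; [|by move=> mu []|exact: vertices_hilbert_ball].
exists (theta0_inv @` (cut_point (theta0 nu) r @` cuts)).
  by do 2!apply: finite_image.
by rewrite conv_hull_theta0_inv.
Qed.
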